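(* Let $(P,\bigvee)$ be a partial semilattice with $P$ finite. Then the semilattice $F_\vee(P,\bigvee)$ freely generated by $(P,\bigvee)$ is isomorphic to $Id(P,\bigvee)\setminus\{\emptyset\}$, with joins given by $A\vee B=\overline{A\cup B}$, where $\overline{Y}$ denotes the intersection of all members of $Id(P,\bigvee)$ containing $Y$. Moreover, $F_\vee(P,\bigvee)$ is, up to isomorphism, the unique semilattice $S$ such that: (A) there is a generating subset of $S$ which as a partial semilattice is isomorphic to $(P,\bigvee)$; and (B) for each semilattice $T$, each partial morphism $\psi:P\to T$ can be extended to a semilattice morphism $\Phi:S\to T$ (where $P$ is identified with the generating subset of (A)).
   Context: Semilattice means $\vee$-semilattice; morphisms preserve binary joins. Partial semilattice: every subset $P$ of a semilattice $S_0$ determines a partial operation $\bigvee$ on nonempty finite subsets $X\subseteq P$: $\bigvee X:=\sup(X)$ (supremum in $S_0$) if $\sup(X)\in P$, and $\bigvee X$ is undefined if $\sup(X)\in S_0\setminus P$. A pair $(P,\bigvee)$ arising in this way is called a partial semilattice. In particular, a subset of any semilattice is regarded as a partial semilattice in this way. An isomorphism of partial semilattices is a bijection $\alpha$ such that $\bigvee X$ is defined if and only if $\bigvee\alpha(X)$ is defined, and then $\alpha(\bigvee X)=\bigvee\alpha(X)$. Underlying poset: $(P,\le)$ is $P$ with the order $b\le a$ iff $\bigvee\{a,b\}$ is defined and equals $a$ (equivalently, the order induced from $S_0$). $\bigvee$-ideals: an order ideal (down-set) $A$ of $(P,\le)$ is a $\bigvee$-ideal if for all nonempty $X\subseteq A$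 for which $\bigvee X$ is defined, one has $\bigvee X\in A$. $Id(P,\bigvee)$ denotes the set of all $\bigvee$-ideals; it is a closure system on $P$ (it contains $P$ and is closed under intersections). Presented semilattices: for a finite set $P$ and a finite set $\mathcal R$ of semilattice relations with symbols from $P$, $F_\vee(P,\mathcal R)$ is the up to isomorphism unique semilattice $S$ such that (a) there is a map $\phi:P\to S$ satisfying the relations from $\mathcal R$ and such that $\phi(P)$ generates $S$, and (b) for each semilattice $T$ and each map $\phi':P\to T$ respecting the relations from $\mathcal R$ there is a $\vee$-homomorphism $\Phi:S\to T$ that extends $\phi'$ (i.e. $\Phi\circ\phi=\phi'$). $F_\vee(P,\bigvee):=F_\vee(P,\mathcal R)$, where $\mathcal R$ consists of the relations $x_1\vee\cdots\vee x_k=\bigvee X$, one for each nonempty subset $X=\{x_1,\dots,x_k\}\subseteq P$ for which $\bigvee X$ is defined. Partial morphism: a map $\psi:P\to T$ into a semilattice $T$ such that $\psi(\bigvee X)=\bigvee\psi(X)$ whenever $\bigvee X$ is defined. *)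

(* Defs.v *)
From HB Require Import structures.
From mathcomp Require Import all_boot all_order finmap.
From mathcomp Require Import boolp classical_sets functions cardinality.

Set Implicit Arguments.
Unset Strict Implicit.
Unset Printing Implicit Defensive.

Import Order.TTheory.

Local Open Scope classical_set_scope.
Local Open Scope order_scope.

Definition join_morph d (S : joinSemilatticeType d) d'
    (T : joinSemilatticeType d') (f : S -> T) : Prop :=
  {morph f : x y / x `|` y >-> x `|` y}.

Definition semilattice_iso d (S : joinSemilatticeType d) d'
    (T : joinSemilatticeType d') : Prop :=
  exists f : S -> T, bijective f /\ join_morph f.

Definition generates d (S : joinSemilatticeType d) (G : set S) : Prop :=
  forall B : set S, G `<=` B -> (forall x y, B x -> B y -> B (x `|` y)) ->
  B = setT.

(* The graph of a partial operation on subsets: [J X a] means that the join of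
   [X] is defined and equal to [a]. *)
Definition partial_join (P : Type) := set P -> P -> Prop.

Definition induced_join d (S : joinSemilatticeType d) (Q : set S) :
    partial_join Q :=
  fun X a => [/\ finite_set X, X !=set0 & supremums (val @` X) (val a)].

Definition partial_iso (P Q : Type) (JP : partial_join P) (JQ : partial_join Q)
    (alpha : P -> Q) : Prop :=
  [/\ bijective alpha,
      forall X, (exists a, JP X a) <-> (exists b, JQ (alpha @` X) b)
    & forall X a, JP X a -> JQ (alpha @` X) (alpha a)].

(* The carrier is an abstract type, so "arising from a subset of a semilattice"
   is understood up to a renaming of the elements. *)
Record partialSemilattice := PartialSemilattice {
  ps_sort :> choiceType;
  ps_join : partial_join ps_sort;
  ps_joinP : exists d (S0 : joinSemilatticeType d) (Q : set S0)
    (alpha : ps_sort -> Q), partial_iso ps_join (@induced_join d S0 Q) alpha }.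

Lemma induced_joinP d (S : joinSemilatticeType d) (Q : set S) :
  exists d0 (S0 : joinSemilatticeType d0) (Q0 : set S0) (alpha : Q -> Q0),
    partial_iso (@induced_join d S Q) (@induced_join d0 S0 Q0) alpha.
Proof.
exists d, S, Q, id; split => [|X|X a]; rewrite ?image_id //.
by exists id.
Qed.

Definition sub_partial d (S : joinSemilatticeType d) (Q : set S) :
    partialSemilattice :=
  @PartialSemilattice Q _ (@induced_joinP d S Q).

Definition ps_le (P : partialSemilattice) (b a : P) : Prop :=
  ps_join [set a; b] a.

Definition partial_morph (P : partialSemilattice) d
    (T : joinSemilatticeType d) (psi : P -> T) : Prop :=
  forall X a, ps_join X a -> supremums (psi @` X) (psi a).

Definition join_ideal (P : partialSemilattice) (A : set P) : Prop :=
  (forall a b, A a -> ps_le b a -> A b) /\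
  (forall X a, X !=set0 -> X `<=` A -> ps_join X a -> A a).

Definition ideal_closure (P : partialSemilattice) (Y : set P) : set P :=
  smallest (@join_ideal P) Y.

Record neideal (P : partialSemilattice) := NeIdeal {
  neideal_set :> set P;
  neidealP : `[< join_ideal neideal_set /\ neideal_set !=set0 >] }.

HB.instance Definition _ P := [isSub for @neideal_set P].
HB.instance Definition _ P := [Choice of neideal P by <:].
(* The order is inclusion. *)
HB.instance Definition _ P :=
  [SubChoice_isSubPOrder of neideal P by <: with set_display].

Lemma ideal_closure_ideal (P : partialSemilattice) (Y : set P) :
  join_ideal (ideal_closure Y).
Proof.
split=> [a b Aa ba I [idI YI]|X a X0 XA Xa I [idI YI]].
- exact: idI.1 (Aa I (conj idI YI)) ba.
- by apply: idI.2 X0 _ Xa => x /XA; apply.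
Qed.

Lemma neideal_join_subproof (P : partialSemilattice) (A B : neideal P) :
  `[< join_ideal (ideal_closure (A `|` B)%classic) /\
      ideal_closure (A `|` B)%classic !=set0 >].
Proof.
apply/asboolP; split; first exact: ideal_closure_ideal.
have /asboolP[_ [x Ax]] := neidealP A.
by exists x => I [_]; apply; left.
Qed.

Definition neideal_join (P : partialSemilattice) (A B : neideal P) :
  neideal P := NeIdeal (neideal_join_subproof A B).

Lemma neideal_leUx (P : partialSemilattice) (A B C : neideal P) :
  (neideal_join A B <= C) = (A <= C) && (B <= C).
Proof.
have leE (D E : neideal P) : (D <= E) <-> (D : set P) `<=` E.
  by rewrite -subsetEset.
have /asboolP[idC _] := neidealP C.
apply/idP/andP => [/leE ABC|[/leE AC /leE BC]].
  by split; apply/leE => x Ax; apply: ABC => I [_]; apply; [left|right].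
by apply/leE => x; apply; split=> // y [/AC|/BC].
Qed.

HB.instance Definition _ (P : partialSemilattice) :=
  Order.POrder_isJoinSemilattice.Build _ (neideal P) (@neideal_leUx P).

Inductive term (P : Type) := Var of P | Join of term P & term P.

Fixpoint eval (P : Type) d (T : joinSemilatticeType d) (phi : P -> T)
    (t : term P) : T :=
  match t with
  | Var p => phi p
  | Join t1 t2 => eval phi t1 `|` eval phi t2
  end.

Definition respects (P : Type) (R : set (term P * term P)) d
    (T : joinSemilatticeType d) (phi : P -> T) : Prop :=
  forall r, R r -> eval phi r.1 = eval phi r.2.

(* The universal property that determines [F_\/(P, R)] up to isomorphism. *)
Definition presented (P : Type) (R : set (term P * term P)) d
    (S : joinSemilatticeType d) : Prop :=
  exists phi : P -> S,
    [/\ respects R phi, generates (range phi)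
      & forall d' (T : joinSemilatticeType d') (phi' : P -> T),
          respects R phi' ->
          exists Phi : S -> T, join_morph Phi /\ Phi \o phi = phi'].

Definition join_term (P : Type) (x : P) (s : seq P) : term P :=
  foldl (fun t y => Join t (Var y)) (Var x) s.

(* One relation [x1 \/ ... \/ xk = a] for each [X = {x1, ..., xk}] whose join
   is defined and equal to [a]; [fset_set] provides the enumeration of [X]. *)
Definition join_relations (P : partialSemilattice) : set (term P * term P) :=
  [set r | exists X a x s, [/\ @ps_join P X a,
     enum_fset (fset_set X) = x :: s & r = (join_term x s, Var a)]].

Definition freely_generated (P : partialSemilattice) d
    (F : joinSemilatticeType d) : Prop :=
  presented (@join_relations P) F.

(* [alpha] identifies [P] with the generating subset [G] of [S]. *)
Definition free_over_copy (P : partialSemilattice) d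
    (S : joinSemilatticeType d) : Prop :=
  exists (G : set S) (alpha : P -> sub_partial G),
    [/\ generates G,
        partial_iso (@ps_join P) (@ps_join (sub_partial G)) alpha
      & forall d' (T : joinSemilatticeType d') (psi : P -> T),
          partial_morph psi ->
          exists Phi : S -> T,
            join_morph Phi /\ forall p, Phi (val (alpha p)) = psi p].

(* Main.v *)
Require Import Defs.
From mathcomp Require Import all_boot all_order finmap.
From mathcomp Require Import boolp classical_sets functions cardinality.

(** Call a map from P to a semilattice S free when it is a partial morphism,
    its range generates S, and every partial morphism out of P factors through
    it.

    Both descriptions of the free semilattice in the theorem say that there is
    a free map.  For the presentation by relations this holds because a
    relation [x1 \/ ... \/ xk = a] is satisfied exactly when [a] is sent to
    the supremum of the images of the [xi].  For the description by a
    generating copy of P, what has to be seen is that a free map [phi]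
    reflects the partial operation ([free_map_reflect]).  Here the origin of P
    is used: P embeds in a semilattice S0 by a partial morphism [e] that
    reflects joins, [e] factors as [E \o phi], and [E] preserves finite
    suprema, so a supremum seen in S is also seen in S0, hence in P.

    By the usual argument, the codomains of two free maps are isomorphic
    ([free_map_iso]).  It remains to find one free map: the map sending [p] to
    its principal ideal [{b | b <= p}], into the nonempty ideals
    ([principal_free]).  A nonempty ideal is finite, hence the finite join of
    the principal ideals of its elements.  The extension of a partial morphism
    [psi] sends an ideal [A] to [sup (psi A)]; it preserves joins because, for
    each [c], the set [{p | psi p <= c}] is again an ideal, so that an upper
    bound of [psi] on [A `|` B] also bounds [psi] on the ideal generated by
    [A `|` B]. *)

Set Implicit Arguments.
Unset Strict Implicit.
Unset Printing Implicit Defensive.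

Import Order.TTheory.

Local Open Scope classical_set_scope.
Local Open Scope order_scope.

(** * Finite suprema in semilattices *)

Lemma supremumsP (P : Type) d (T : porderType d) (f : P -> T) (X : set P)
    (v : T) :
  supremums (f @` X) v <->
  forall c, (v <= c) <-> (forall x, X x -> f x <= c).
Proof.
split=> [[ubv lbv] c|supv].
  split=> [vc x Xx|fc]; first exact: le_trans (ubv _ (imageP f Xx)) vc.
  by apply: lbv => _ [x Xx <-]; apply: fc.
split=> [_ [x Xx <-]|c ubc]; first exact: (supv v).1.
by apply/supv => x Xx; apply: ubc; exists x.
Qed.

Lemma supremums_inj d (T : porderType d) (A : set T) (v w : T) :
  supremums A v -> supremums A w -> v = w.
Proof.
by move=> [ubv lbv] [ubw lbw]; apply/le_anti; rewrite lbv// lbw.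
Qed.

Lemma eval_join_term_sup (P : eqType) d (T : joinSemilatticeType d)
    (f : P -> T) (x : P) (s : seq P) :
  supremums (f @` [set` x :: s]) (eval f (join_term x s)).
Proof.
apply/supremumsP => c; elim/last_ind: s => [|s y IH].
  split=> [xc z /=|]; first by rewrite inE => /eqP ->.
  by apply; rewrite /= mem_head.
rewrite /join_term foldl_rcons /= -/(join_term x s) leUx.
split=> [/andP[/IH sc yc] z /=|sc].
  by rewrite -rcons_cons mem_rcons inE => /orP[/eqP -> //|/sc].
apply/andP; split.
  by apply/IH => z zs; apply: sc; rewrite /= -rcons_cons mem_rcons inE zs orbT.
by apply: sc; rewrite /= -rcons_cons mem_rcons mem_head.
Qed.

Lemma finite_set_enum (P : choiceType) (X : set P) :
  finite_set X -> X !=set0 ->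
  exists x s, enum_fset (fset_set X) = x :: s /\ X = [set` x :: s].
Proof.
move=> finX [y Xy].
have XE : X = [set` enum_fset (fset_set X)].
  by apply/seteqP; split=> z /=; rewrite in_fset_set// inE.
case: (enum_fset _) XE => [|x s] XE; last by exists x, s.
by move: Xy; rewrite XE.
Qed.

Lemma finite_sup (P : choiceType) d (T : joinSemilatticeType d) (f : P -> T)
    (X : set P) :
  finite_set X -> X !=set0 -> exists v, supremums (f @` X) v.
Proof.
move=> finX X0; have [x [s [_ ->]]] := finite_set_enum finX X0.
by exists (eval f (join_term x s)); apply: eval_join_term_sup.
Qed.

Lemma eval_morph (P : Type) d (S : joinSemilatticeType d) d'
    (T : joinSemilatticeType d') (h : S -> T) (f : P -> S) (t : term P) :
  join_morph h -> h (eval f t) = eval (h \o f) t.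
Proof. by move=> hM; elim: t => //= t1 IH1 t2 IH2; rewrite hM IH1 IH2. Qed.

(** A finite nonempty supremum is the value of a term, and morphisms commute
    with the evaluation of terms. *)
Lemma join_morph_sup (P : choiceType) d (S : joinSemilatticeType d) d'
    (T : joinSemilatticeType d') (h : S -> T) (f : P -> S) (X : set P) (v : S) :
  join_morph h -> finite_set X -> X !=set0 ->
  supremums (f @` X) v -> supremums ((h \o f) @` X) (h v).
Proof.
move=> hM finX X0; have [x [s [_ ->]]] := finite_set_enum finX X0.
move=> /supremums_inj/(_ (eval_join_term_sup f x s)) ->.
by rewrite eval_morph//; apply: eval_join_term_sup.
Qed.

Lemma closed_eval (P : Type) d (S : joinSemilatticeType d) (f : P -> S)
    (B : set S) (t : term P) :
  range f `<=` B -> (forall x y, B x -> B y -> B (x `|` y)) -> B (eval f t).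
Proof. by move=> fB BU; elim: t => /= [p|t1 ? t2 ?]; [apply: fB|apply: BU]. Qed.

Lemma eq_on_generators d (S : joinSemilatticeType d) d'
    (T : joinSemilatticeType d') (G : set S) (f g : S -> T) :
  generates G -> join_morph f -> join_morph g -> {in G, f =1 g} -> f =1 g.
Proof.
move=> genG fM gM fg x.
suff : [set y | f y = g y] x by [].
by rewrite (genG [set y | f y = g y])// => [y Gy|y z /= fy fz]; [apply: fg; rewrite inE|
  rewrite fM gM fy fz].
Qed.

(** * Partial semilattices *)

(** Definedness is only related to that of the copy through [alpha @` X], but
    since suprema are unique the value is then forced as well; this turns the
    three clauses of an isomorphism into a single equivalence. *)
Lemma partial_iso_inducedP (P : Type) (J : partial_join P) d
    (S : joinSemilatticeType d) (Q : set S) (alpha : P -> Q) :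
  partial_iso J (@induced_join d S Q) alpha <->
  bijective alpha /\
  forall X a, J X a <->
    [/\ finite_set X, X !=set0
      & supremums ((fun p => val (alpha p)) @` X) (val (alpha a))].
Proof.
have indE X a : bijective alpha ->
    @induced_join d S Q (alpha @` X) (alpha a) <->
    [/\ finite_set X, X !=set0
      & supremums ((fun p => val (alpha p)) @` X) (val (alpha a))].
  move=> /bij_inj inj_alpha; rewrite /induced_join image_comp.
  split=> -[finX X0 supX]; split=> //.
  - rewrite -(@eq_finite_set _ _ (alpha @` X))//.
    by apply: inj_card_eq => x y _ _; apply: inj_alpha.
  - by case: X0 => _ [x Xx _]; exists x.
  - exact: finite_image.
  - by case: X0 => x Xx; exists (alpha x), x.
split=> [[bij defJ valJ]|[bij JE]]; split=> //.
- move=> X a; split=> [Xa|/(indE _ _ bij) Xa]; first exact/indE/valJ.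
  have [b Xb] := (defJ X).2 (ex_intro _ _ Xa).
  suff -> : a = b by [].
  case: (valJ X b Xb) Xa => _ _ supb [_ _ supa].
  exact/(bij_inj bij)/val_inj/(supremums_inj supa).
- move=> X; split=> [[a /JE Xa]|[b]]; first by exists (alpha a); apply/indE.
  have [beta _ betaK] := bij; rewrite -(betaK b) => /(indE _ _ bij) Xb.
  by exists (beta b); apply/JE.
- by move=> X a /JE Xa; apply/indE.
Qed.

Lemma ps_embedding (P : partialSemilattice) :
  exists d (S0 : joinSemilatticeType d) (e : P -> S0), injective e /\
    forall X a, ps_join X a <->
      [/\ finite_set X, X !=set0 & supremums (e @` X) (e a)].
Proof.
have [d [S0 [Q [alpha /partial_iso_inducedP[bij JE]]]]] := ps_joinP P.
exists d, S0, (fun p => val (alpha p)); split=> // x y /val_inj.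
exact: bij_inj.
Qed.

Lemma ps_join_finite (P : partialSemilattice) (X : set P) (a : P) :
  ps_join X a -> finite_set X /\ X !=set0.
Proof. by have [d [S0 [e [_ JE]]]] := ps_embedding P => /JE[]. Qed.

Lemma ps_leP (P : partialSemilattice) d (S0 : joinSemilatticeType d)
    (e : P -> S0) :
  (forall X a, ps_join X a <->
      [/\ finite_set X, X !=set0 & supremums (e @` X) (e a)]) ->
  forall b a : P, ps_le b a <-> e b <= e a.
Proof.
move=> JE b a; rewrite /ps_le JE; split=> [[_ _ [ub _]]|ba].
  by apply: ub; exists b; [right|].
split; [exact: finite_set2|by exists a; left|].
apply/supremumsP => c; split=> [ac x [->|->] //|]; last by apply; left.
exact: le_trans ba ac.
Qed.

Lemma partial_morph_le (P : partialSemilattice) d (T : joinSemilatticeType d)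
    (psi : P -> T) (a b : P) :
  partial_morph psi -> ps_le b a -> psi b <= psi a.
Proof. by move=> psiM /psiM[ub _]; apply: ub; exists b => //; right. Qed.

(** Turns a bound for [psi] on generators into a bound on the ideal that they
    generate. *)
Lemma bounded_join_ideal (P : partialSemilattice) d
    (T : joinSemilatticeType d) (psi : P -> T) (c : T) :
  partial_morph psi -> join_ideal [set p | psi p <= c].
Proof.
move=> psiM; split=> [a b /= ac /(partial_morph_le psiM) ba|X a _ XA /psiM].
  exact: le_trans ac.
by move/supremumsP => supX; apply/supX => x /XA.
Qed.

(** A relation equates [psi a] with the join of [psi] along one enumeration of
    [X]; the value of that join does not depend on the enumeration. *)
Lemma respects_join_relations (P : partialSemilattice) d
    (T : joinSemilatticeType d) (psi : P -> T) :
  respects (@join_relations P) psi <-> partial_morph psi.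
Proof.
split=> [resp X a Xa|psiM _ [X [a [x [s [Xa sE ->]]]]] /=].
  have [finX X0] := ps_join_finite Xa.
  have [x [s [sE ->]]] := finite_set_enum finX X0.
  have /= <- := resp (join_term x s, Var a) (ex_intro _ X (ex_intro _ a
    (ex_intro _ x (ex_intro _ s (And3 Xa sE erefl))))).
  exact: eval_join_term_sup.
have [finX X0] := ps_join_finite Xa.
have [y [u [uE XE]]] := finite_set_enum finX X0.
move: uE XE; rewrite sE => -[<- <-] XE.
by apply: supremums_inj (psiM _ _ Xa); rewrite XE; apply: eval_join_term_sup.
Qed.

(** * Free maps *)

Definition free_map (P : partialSemilattice) d (S : joinSemilatticeType d)
    (phi : P -> S) : Prop :=
  [/\ partial_morph phi, generates (range phi)
    & forall d' (T : joinSemilatticeType d') (psi : P -> T),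
        partial_morph psi ->
        exists Phi : S -> T, join_morph Phi /\ Phi \o phi = psi].

Lemma freely_generatedP (P : partialSemilattice) d
    (S : joinSemilatticeType d) :
  freely_generated P S <-> exists phi : P -> S, free_map phi.
Proof.
split=> -[phi [phiM gen univ]]; exists phi; split=> //.
- exact/respects_join_relations.
- by move=> d' T psi /respects_join_relations; apply: univ.
- exact/respects_join_relations.
- by move=> d' T psi /respects_join_relations; apply: univ.
Qed.

(** An embedding of [P] in a semilattice factors through [phi], so [phi]
    identifies no two elements and creates no new joins. *)
Lemma free_map_reflect (P : partialSemilattice) d (S : joinSemilatticeType d)
    (phi : P -> S) :
  free_map phi -> injective phi /\
  forall X a, ps_join X a <->
    [/\ finite_set X, X !=set0 & supremums (phi @` X) (phi a)].
Proof.
move=> [phiM _ univ]; have [d0 [S0 [e [inj_e JE]]]] := ps_embedding P.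
have eM : partial_morph e by move=> X a /JE[].
have [E [EM Ephi]] := univ _ _ _ eM.
split=> [x y phixy|X a]; first by apply: inj_e; rewrite -Ephi /= phixy.
split=> [Xa|[finX X0 /(join_morph_sup EM finX X0)]].
  by have [finX X0] := ps_join_finite Xa; split=> //; apply: phiM.
by rewrite -[E (phi a)]/((E \o phi) a) Ephi => supX; apply/JE.
Qed.

Lemma free_over_copyP (P : partialSemilattice) d (S : joinSemilatticeType d) :
  free_over_copy P S <-> exists phi : P -> S, free_map phi.
Proof.
split=> [[G [alpha [gen /partial_iso_inducedP[bij JE] univ]]]|[phi phiF]].
  exists (fun p => val (alpha p)); split.
  - by move=> X a /JE[].
  - suff -> : range (fun p => val (alpha p)) = G by [].
    apply/seteqP; split=> [_ [p _ <-]|x Gx]; first exact: set_valP.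
    have [beta _ betaK] := bij.
    by exists (beta (SigSub (mem_set Gx))); rewrite ?betaK.
  - move=> d' T psi /univ[Phi [PhiM PhiE]]; exists Phi; split=> //.
    exact/funext.
have [inj_phi JE] := free_map_reflect phiF; have [phiM gen univ] := phiF.
have phiP p : phi p \in range phi by rewrite inE; exists p.
exists (range phi), (fun p => SigSub (phiP p)); split=> //.
  apply/partial_iso_inducedP; split=> //.
  have /choice[beta betaP] (q : range phi) : exists p, phi p = val q.
    by have [p _ <-] := set_valP q; exists p.
  exists beta => [p|q]; first exact/inj_phi/betaP.
  exact/val_inj/betaP.
move=> d' T psi /univ[Phi [PhiM <-]]; by exists Phi.
Qed.

Lemma free_map_iso (P : partialSemilattice) d (S : joinSemilatticeType d)
    (phi : P -> S) d' (T : joinSemilatticeType d') (psi : P -> T) :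
  free_map phi -> free_map psi -> semilattice_iso S T.
Proof.
move=> [phiM phiG phiU] [psiM psiG psiU].
have [f [fM fphi]] := phiU _ _ _ psiM; have [g [gM gpsi]] := psiU _ _ _ phiM.
exists f; split=> //; exists g.
  apply: (@eq_on_generators _ S _ S _ (g \o f) id phiG) => //.
    by move=> x y /=; rewrite fM gM.
  by move=> _ /[!inE] -[p _ <-]; rewrite -[in RHS]gpsi -fphi.
apply: (@eq_on_generators _ T _ T _ (f \o g) id psiG) => //.
  by move=> x y /=; rewrite gM fM.
by move=> _ /[!inE] -[p _ <-]; rewrite -[in RHS]fphi -gpsi.
Qed.

(** * The semilattice of nonempty ideals *)

Lemma neideal_leP (P : partialSemilattice) (A B : neideal P) :
  A <= B <-> neideal_set A `<=` neideal_set B.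
Proof. by rewrite -subsetEset. Qed.

Lemma neideal_join_ideal (P : partialSemilattice) (A : neideal P) :
  join_ideal (neideal_set A).
Proof. by have /asboolP[] := neidealP A. Qed.

Lemma neideal_neq0 (P : partialSemilattice) (A : neideal P) :
  neideal_set A !=set0.
Proof. by have /asboolP[] := neidealP A. Qed.

Lemma principal_subproof (P : partialSemilattice) (p : P) :
  `[< join_ideal [set b | ps_le b p] /\ [set b | ps_le b p] !=set0 >].
Proof.
have [d [S0 [e [_ JE]]]] := ps_embedding P.
apply/asboolP; split; last by exists p; apply/(ps_leP JE).
have -> : [set b | ps_le b p] = [set b | e b <= e p].
  by apply/seteqP; split=> b /(ps_leP JE).
by apply: bounded_join_ideal => X a /JE[].
Qed.

Definition principal (P : partialSemilattice) (p : P) : neideal P :=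
  NeIdeal (principal_subproof p).

Lemma ps_le_refl (P : partialSemilattice) (p : P) : ps_le p p.
Proof.
by have [d [S0 [e [_ JE]]]] := ps_embedding P; apply/(ps_leP JE).
Qed.

Lemma principal_le (P : partialSemilattice) (p : P) (A : neideal P) :
  principal p <= A <-> neideal_set A p.
Proof.
split=> [/neideal_leP|Ap]; first by apply; apply: ps_le_refl.
by apply/neideal_leP => b; apply: (neideal_join_ideal A).1.
Qed.

Lemma principal_partial_morph (P : partialSemilattice) :
  partial_morph (@principal P).
Proof.
move=> X a Xa; have [_ X0] := ps_join_finite Xa.
apply/supremumsP => C; rewrite principal_le; split=> [Ca x Xx|XC].
  (* [a] bounds [X] in [P] because it does in an ambient semilattice *)
  have [d [S0 [e [_ JE]]]] := ps_embedding P.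
  apply/principal_le; apply: (neideal_join_ideal C).1 Ca _.
  apply/(ps_leP JE).
  by have /JE[_ _ [ub _]] := Xa; apply: ub; exists x.
by apply: (neideal_join_ideal C).2 X0 _ Xa => x /XC /principal_le.
Qed.

Lemma neideal_sup_principal (P : partialSemilattice) (A : neideal P) :
  supremums (@principal P @` neideal_set A) A.
Proof.
apply/supremumsP => C; rewrite neideal_leP.
by split=> AC x /AC /principal_le.
Qed.

(** Every nonempty ideal, being finite, is the value of a term at the principal
    ideals of its elements. *)
Lemma principal_generates (P : partialSemilattice) :
  finite_set [set: P] -> generates (range (@principal P)).
Proof.
move=> finP B pB BU; apply/seteqP; split=> // A _.
have finA : finite_set (neideal_set A) by apply: sub_finite_set finP.
have [x [s [_ AE]]] := finite_set_enum finA (neideal_neq0 A).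
have := @neideal_sup_principal P A; rewrite AE.
move=> /supremums_inj/(_ (eval_join_term_sup _ x s)) ->.
exact: closed_eval.
Qed.

(** The extension of a partial morphism [psi] is [A |-> sup (psi A)], which
    exists because [A] is finite and nonempty.  It is characterized by the
    equivalence [Phi A <= c <-> A `<=` [set p | psi p <= c]], from which
    everything follows. *)
Lemma principal_free (P : partialSemilattice) :
  finite_set [set: P] -> free_map (@principal P).
Proof.
move=> finP; split=> [||d T psi psiM];
  [exact: principal_partial_morph|exact: principal_generates|].
have /choice[Phi PhiP] (A : neideal P) :
    exists v, supremums (psi @` neideal_set A) v.
  by apply: finite_sup (neideal_neq0 A); apply: sub_finite_set finP.
have {}PhiP A c : Phi A <= c <-> neideal_set A `<=` [set p | psi p <= c].
  exact: (supremumsP psi _ _).1 (PhiP A) c.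
exists Phi; split=> [A B|].
  apply/le_anti/andP; split.
    apply/PhiP => p; apply; split; first exact: bounded_join_ideal.
    by move=> q [] q_in; [apply: le_trans (leUl _ _)|apply: le_trans (leUr _ _)];
      apply: (PhiP _ _).1 q_in.
  have mono (C D : neideal P) : C <= D -> Phi C <= Phi D.
    move=> /neideal_leP CD; apply/PhiP.
    by apply: subset_trans CD _; apply/PhiP.
  by rewrite leUx !mono ?leUl ?leUr.
apply/funext => p /=; apply/le_anti/andP; split.
  by apply/PhiP => b; apply: partial_morph_le.
exact: (PhiP (principal p) _).1 (lexx _) p (ps_le_refl p).
Qed.

Theorem corollary2 (P : partialSemilattice)
    (finP : finite_set (@setT P)) :
  (forall A B : neideal P,
     neideal_set (A `|` B)%O =
     ideal_closure (neideal_set A `|` neideal_set B)%classic) /\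
  (exists d (F : joinSemilatticeType d), freely_generated P F) /\
  (forall d (F : joinSemilatticeType d), freely_generated P F ->
     [/\ semilattice_iso F (neideal P),
         free_over_copy P F
       & forall d' (S : joinSemilatticeType d'),
           free_over_copy P S -> semilattice_iso S F]).
Proof.
have idF := principal_free finP.
split; first by [].
split.
  by exists _, (neideal P); apply/freely_generatedP; exists (@principal P).
move=> d F /freely_generatedP[phi phiF]; split.
- exact: free_map_iso phiF idF.
- by apply/free_over_copyP; exists phi.
- by move=> d' S /free_over_copyP[psi psiF]; apply: free_map_iso psiF phiF.
Qed.
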